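(* Let $p$ be a Gauss phrase. Then $S_o(p)$ is an open homotopy invariant of $p$; that is, if $p$ and $q$ are open homotopic $n$-component Gauss phrases, then $S_o(p)=S_o(q)$, i.e. $B_k(p)=B_k(q)$ for all $1\le k\le n$.
   Context: A word on an alphabet (finite set) $\mathcal{A}$ is a finite, possibly empty, sequence of letters of $\mathcal{A}$. A Gauss word on $\mathcal{A}$ is a word on $\mathcal{A}$ in which every letter of $\mathcal{A}$ appears exactly twice. A Gauss phrase on $\mathcal{A}$ is a finite sequence of words $x_1,\dots,x_m$ on $\mathcal{A}$ (written $x_1|\cdots|x_m$) whose concatenation $x_1x_2\cdots x_m$ is a Gauss word on $\mathcal{A}$; the $x_i$ are its components. Different Gauss phrases may have different alphabets. Isomorphism: Gauss phrases $p_1$ on $\mathcal{A}_1$ and $p_2$ on $\mathcal{A}_2$ are isomorphic if there is a bijection $\mathcal{A}_1\to\mathcal{A}_2$ which applied letterwise to $p_1$ gives $p_2$. Homotopy moves. Below $A,B,C$ are individual (distinct) letters, and $w,x,y,z$ are arbitrary (possibly empty) sequences of letters, possibly including the separator $|$; each move starts and ends with a Gauss phrase. H1: $xAAy \to xy$. H2: $xAByBAz \to xyz$. H3: $wABxACyBCz \to wBAxCAyCBz$. (In each move each displayed two-letter subword lies in a single component; different subwords may lie in the same or different components. The inverses of H1 and H2 insert letters not already appearing in the phrase.) Two Gauss phrases are open homotopic if they are related by a finite sequence of isomorphisms and the moves H1, H2, H3 and their inverses. All these operations preserve the number and order of components. Write $K_n=(\mathbb{Z}/2\mathbb{Z})^n$.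 Let $p$ be an $n$-component Gauss phrase. For a (contiguous) subword $w$ of a component of $p$, the linking vector $\overrightarrow{l(w)}\in K_n$ is the vector whose $i$th entry is the number, modulo $2$, of letters which occur exactly once in $w$ and whose other occurrence is in the $i$th component of $p$. A single-component letter is a letter both of whose occurrences are in the same component. If $A$ is a single-component letter in the $k$th component, that component has the form $xAyAz$ with $x,y,z$ possibly empty words, and the linking vector of $A$ is $\overrightarrow{l(A)}=\overrightarrow{l(y)}$. Let $\mathcal{A}_k$ be the set of single-component letters appearing in the $k$th component of $p$, and for $\vec v\in K_n$ let $d_k(\vec v)=\#\{X\in\mathcal{A}_k : \overrightarrow{l(X)}=\vec v\}$. Define $$B_k(p)=\{\vec v\in K_n-\{\vec 0\} : d_k(\vec v)\text{ is odd}\},$$ and $S_o(p)=(B_1(p),\dots,B_n(p))$. *)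

(* Defs.v *)
From HB Require Import structures.
From mathcomp Require Import all_boot all_order all_algebra.

Set Implicit Arguments.
Unset Strict Implicit.
Unset Printing Implicit Defensive.

Import GRing.Theory.

(* An alphabet is a finType, a word on it is a seq, and an n-component phrase
   is an n-tuple of words. *)
Definition gauss_word (T : finType) (w : seq T) : bool :=
  [forall a : T, count_mem a w == 2].

Record gauss_phrase (n : nat) (T : finType) := GaussPhrase {
  components :> n.-tuple (seq T);
  gauss_phraseP : gauss_word (flatten components)
}.

(* The phrase x_1|...|x_m as one sequence: [Some a] is the letter a and [None]
   is the separator. *)
Definition barred (T : Type) (ws : seq (seq T)) : seq (option T) :=
  if ws is w :: ws' then
    map Some w ++ flatten [seq None :: map Some w' | w' <- ws']
  else [::].

Definition relabel (T1 T2 : Type) (f : T1 -> T2) (ws : seq (seq T1)) :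
    seq (seq T2) :=
  map (map f) ws.

(* H1 and H2 delete letters, so their target has the smaller alphabet T - {a},
   resp. T - {a, b}, represented by a subtype of T with inclusion [val]. *)
Inductive elementary_step (n : nat) : forall T1 T2 : finType,
    gauss_phrase n T1 -> gauss_phrase n T2 -> Prop :=
| step_iso (T1 T2 : finType) (p : gauss_phrase n T1) (q : gauss_phrase n T2)
    (f : T1 -> T2) :
    bijective f ->
    relabel f p = q ->
    elementary_step p q
| step_H1 (T : finType) (a : T)
    (p : gauss_phrase n T) (q : gauss_phrase n {c : T | c != a})
    (x y : seq (option T)) :
    barred p = x ++ [:: Some a; Some a] ++ y ->
    barred (relabel val q) = x ++ y ->
    elementary_step p q
| step_H2 (T : finType) (a b : T)
    (p : gauss_phrase n T) (q : gauss_phrase n {c : T | (c != a) && (c != b)})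
    (x y z : seq (option T)) :
    a != b ->
    barred p = x ++ [:: Some a; Some b] ++ y ++ [:: Some b; Some a] ++ z ->
    barred (relabel val q) = x ++ y ++ z ->
    elementary_step p q
| step_H3 (T : finType) (a b c : T) (p q : gauss_phrase n T)
    (w x y z : seq (option T)) :
    uniq [:: a; b; c] ->
    barred p = w ++ [:: Some a; Some b] ++ x ++ [:: Some a; Some c] ++ y
                 ++ [:: Some b; Some c] ++ z ->
    barred q = w ++ [:: Some b; Some a] ++ x ++ [:: Some c; Some a] ++ y
                 ++ [:: Some c; Some b] ++ z ->
    elementary_step p q.

Inductive open_homotopic (n : nat) : forall T1 T2 : finType,
    gauss_phrase n T1 -> gauss_phrase n T2 -> Prop :=
| oh_refl (T : finType) (p : gauss_phrase n T) : open_homotopic p p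
| oh_step (T1 T2 : finType) (p : gauss_phrase n T1) (q : gauss_phrase n T2) :
    elementary_step p q -> open_homotopic p q
| oh_sym (T1 T2 : finType) (p : gauss_phrase n T1) (q : gauss_phrase n T2) :
    open_homotopic p q -> open_homotopic q p
| oh_trans (T1 T2 T3 : finType) (p : gauss_phrase n T1)
    (q : gauss_phrase n T2) (r : gauss_phrase n T3) :
    open_homotopic p q -> open_homotopic q r -> open_homotopic p r.

(* A contiguous subword is given by its positions s <= j < t, so that the
   occurrences lying outside of it are well defined. *)
Definition subword (T : Type) (c : seq T) (s t : nat) : seq T :=
  drop s (take t c).

Definition outside (T : Type) (c : seq T) (s t : nat) : seq T :=
  take s c ++ drop t c.

Section LinkingVectors.
Variables (n : nat) (T : finType) (p : gauss_phrase n T).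

(* A letter occurring exactly once in the subword has its other occurrence in
   the i-th component iff it appears there outside of the subword. *)
Definition linking_vector (k : 'I_n) (s t : nat) : 'rV['F_2]_n :=
  \row_(i < n)
    (#|[set a : T | (count_mem a (subword (tnth p k) s t) == 1)
         && (a \in (if i == k then outside (tnth p k) s t
                    else tnth p i))]|%:R)%R.

Definition single_component_letters (k : 'I_n) : {set T} :=
  [set a : T | count_mem a (tnth p k) == 2].

Definition first_pos (k : 'I_n) (a : T) : nat := index a (tnth p k).

Definition second_pos (k : 'I_n) (a : T) : nat :=
  (first_pos k a).+1 + index a (drop (first_pos k a).+1 (tnth p k)).

(* The linking vector of the word strictly between the two occurrences of a;
   meaningful for a in [single_component_letters k]. *)
Definition letter_linking_vector (k : 'I_n) (a : T) : 'rV['F_2]_n :=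
  linking_vector k (first_pos k a).+1 (second_pos k a).

Definition d_ (k : 'I_n) (v : 'rV['F_2]_n) : nat :=
  #|[set a in single_component_letters k | letter_linking_vector k a == v]|.

Definition B_ (k : 'I_n) : {set 'rV['F_2]_n} :=
  [set v : 'rV['F_2]_n | (v != 0%R) && odd (d_ k v)].

Definition S_o : n.-tuple {set 'rV['F_2]_n} := [tuple B_ k | k < n].

End LinkingVectors.

(* Main.v *)
Require Import Defs.
From mathcomp Require Import all_boot all_order all_algebra zify.

(* Over 'F_2, give a letter c of the k-th component the weight e_i + e_j + e_k,
   where i and j are the components of its two occurrences. The linking vector
   of a subword of the k-th component is then the sum of the weights of its
   letters. Hence the linking vector of a single-component letter c is, up to
   adding the weight of c itself, the sum of the two prefix sums of weights that
   end at its occurrences. Prefix sums are additive under concatenation, so the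
   effect of each move on them is a direct computation on the whole phrase: H1
   adds a letter of linking vector 0, H2 adds two letters with equal linking
   vectors, and H3 changes no linking vector, because if one of its three
   letters is single-component then the other two have equal weights. *)

Set Implicit Arguments.
Unset Strict Implicit.
Unset Printing Implicit Defensive.

Import GRing.Theory.
Local Open Scope ring_scope.

(** * Sums over the occurrences of a letter *)

Section OccurrenceSum.
Variables (T : eqType) (V M : nmodType) (F : V -> M).
Implicit Types (g : option T -> V) (acc : V) (c : T) (s : seq (option T)).

(** The accumulator at an occurrence of [c] is the weight of everything strictly before it. The two
    uses are [F] an indicator on [nat], which counts occurrences by component, and [F = id] over
    ['F_2], which adds up prefix sums. *)
Fixpoint occurrence_sum g acc c s : M :=
  if s is o :: s' then
    (if o == Some c then F acc else 0) + occurrence_sum g (acc + g o) c s'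
  else 0.

Lemma occurrence_sum_cons g acc c o s :
  occurrence_sum g acc c (o :: s) =
  (if o == Some c then F acc else 0) + occurrence_sum g (acc + g o) c s.
Proof. by []. Qed.

Lemma occurrence_sum_cat g acc c s1 s2 :
  occurrence_sum g acc c (s1 ++ s2) =
  occurrence_sum g acc c s1 + occurrence_sum g (acc + \sum_(o <- s1) g o) c s2.
Proof.
elim: s1 acc => [|o s1 IH] acc /=; first by rewrite big_nil addr0 add0r.
by rewrite IH big_cons !addrA.
Qed.

Lemma occurrence_sum_notin g acc c s :
  Some c \notin s -> occurrence_sum g acc c s = 0.
Proof.
elim: s acc => //= o s IH acc; rewrite inE negb_or eq_sym => /andP[/negPf-> cs].
by rewrite IH // addr0.
Qed.

Lemma eq_in_occurrence_sum g1 g2 acc c s :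
  {in s, g1 =1 g2} -> occurrence_sum g1 acc c s = occurrence_sum g2 acc c s.
Proof.
elim: s acc => //= o s IH acc eq_g; rewrite eq_g ?mem_head // IH // => d ds.
by rewrite eq_g // inE ds orbT.
Qed.

End OccurrenceSum.

Lemma occurrence_sum_map (T1 T2 : eqType) (V M : nmodType) (F : V -> M)
    (f : T1 -> T2) (g : option T2 -> V) (acc : V) (c : T1)
    (s : seq (option T1)) :
  injective f ->
  occurrence_sum F g acc (f c) (map (omap f) s) =
  occurrence_sum F (g \o omap f) acc c s.
Proof.
move=> inj_f; elim: s acc => //= -[d|] s IH acc; rewrite IH //=.
by rewrite !(inj_eq Some_inj) (inj_eq inj_f).
Qed.

(** * Component counts and linking data of barred sequences *)

Definition separator_weight (T : eqType) (o : option T) : nat := o == None.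

(* The i-th component consists of the letters preceded by i separators. *)
Definition component_count (T : eqType) (s : seq (option T)) (i : nat) (c : T)
    : nat :=
  occurrence_sum (fun m : nat => (m == i : nat)) (@separator_weight T) 0%N c s.

Definition letter_weight (n : nat) (T : eqType) (s : seq (option T)) (k : 'I_n)
    (c : T) : 'rV['F_2]_n :=
  \row_(i < n) (component_count s i c + (i == k))%N%:R.

(* Modulo 2, the prefix sums up to the two occurrences of c add up to the
   weight of the first c and of what lies between the two. *)
Definition barred_linking (n : nat) (T : eqType) (s : seq (option T))
    (k : 'I_n) (c : T) : 'rV['F_2]_n :=
  occurrence_sum id (oapp (letter_weight s k) 0) 0 c s + letter_weight s k c.

(** Since [s] is arbitrary, both sides of H1 and H2 can be compared over the larger alphabet: a
    deleted letter does not occur in the target, so it is not linked there. *)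
Definition linked (n : nat) (T : eqType) (s : seq (option T)) (k : 'I_n)
    (v : 'rV['F_2]_n) (c : T) : bool :=
  (component_count s k c == 2) && (barred_linking s k c == v).

(** * Arithmetic over ['F_2] *)

Lemma F2_cases (x : 'F_2) : x = 0 \/ x = 1.
Proof. by case: x => [[|[|m]] lt_m2] //; [left | right]; apply/val_inj. Qed.

Lemma F2_11 : 1 + 1 = 0 :> 'F_2.
Proof. exact/val_inj. Qed.

Lemma natr_F2 (m : nat) : m%:R = (odd m)%:R :> 'F_2.
Proof.
by rewrite -[in LHS](odd_double_half m) natrD -mul2n natrM pchar_Zp // mul0r addr0.
Qed.

Lemma eq_natr_F2 (l m : nat) : odd l = odd m -> l%:R = m%:R :> 'F_2.
Proof. by move=> eq_lm; rewrite [LHS]natr_F2 [RHS]natr_F2 eq_lm. Qed.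

Lemma mxD (m n : nat) (V : zmodType) (u v : 'M[V]_(m, n)) i j :
  (u + v) i j = u i j + v i j.
Proof. exact: mxE. Qed.

Lemma mx0 (m n : nat) (V : zmodType) i j : (0 : 'M[V]_(m, n)) i j = 0.
Proof. exact: mxE. Qed.

(* Decides linear identities between vectors over 'F_2 by enumerating the
   values of their entries. *)
Ltac char2_row :=
  repeat match goal with
  | |- context [letter_weight ?s ?k ?c] =>
    let g := fresh in move: (letter_weight s k c) => g
  | |- context [\sum_(o <- ?s) ?F o] =>
    let S := fresh in move: (\sum_(o <- s) F o) => S
  end;
  apply/rowP => ?; rewrite ?(mxD, mx0);
  repeat match goal with |- context [fun_of_matrix ?u ?i ?j] =>
    case: (F2_cases (fun_of_matrix u i j)) => ->; rewrite ?(add0r, addr0, F2_11)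
  end;
  reflexivity.

Lemma addvv (n : nat) (u : 'rV['F_2]_n) : u + u = 0.
Proof. char2_row. Qed.

(** * Injective relabelling *)

Lemma component_count_map (T1 T2 : eqType) (f : T1 -> T2)
    (s : seq (option T1)) i c :
  injective f -> component_count (map (omap f) s) i (f c) = component_count s i c.
Proof.
move=> inj_f; rewrite /component_count occurrence_sum_map //.
by apply: eq_in_occurrence_sum => -[].
Qed.

Lemma component_count_notin (T : eqType) (s : seq (option T)) i c :
  Some c \notin s -> component_count s i c = 0%N.
Proof. exact: occurrence_sum_notin. Qed.

Lemma linked_notin (n : nat) (T : eqType) (s : seq (option T)) (k : 'I_n) v c :
  Some c \notin s -> linked s k v c = false.
Proof. by move=> cs; rewrite /linked component_count_notin. Qed.

Lemma linked_map n (T1 T2 : eqType) (f : T1 -> T2) (s : seq (option T1))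
    (k : 'I_n) v c :
  injective f -> linked (map (omap f) s) k v (f c) = linked s k v c.
Proof.
move=> inj_f; rewrite /linked component_count_map //.
have E d : letter_weight (map (omap f) s) k (f d) = letter_weight s k d.
  by apply/rowP => i; rewrite !mxE component_count_map.
congr (_ && (_ == _)); rewrite /barred_linking E occurrence_sum_map //.
by congr (_ + _); apply: eq_in_occurrence_sum => -[d|] //= _; apply: E.
Qed.

(** Letters outside the image of [f] do not occur in the relabelled sequence, hence are not linked.
    This covers isomorphisms as well as the inclusions [val] of the smaller alphabets in H1 and
    H2. *)
Lemma card_linked_map n (T1 T2 : finType) (f : T1 -> T2) (s : seq (option T1))
    (k : 'I_n) v :
  injective f ->
  #|[pred c | linked (map (omap f) s) k v c]| = #|[pred c | linked s k v c]|.
Proof.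
move=> inj_f; rewrite -(card_image inj_f [pred c | linked s k v c]).
apply: eq_card => d; apply/idP/imageP => [|[c]]; rewrite !inE; last first.
  by move=> ? ->; rewrite linked_map.
move=> ld; case: (boolP (Some d \in map (omap f) s)) => [|/linked_notin dN].
  case/mapP=> -[c|//] _ [dE]; exists c => //.
  by rewrite inE -(linked_map _ _ _ _ inj_f) -dE.
by rewrite dN in ld.
Qed.

(** * From barred sequences back to words *)

Lemma barred_cons2 (T : Type) (w w' : seq T) ws :
  barred (w :: w' :: ws) = map Some w ++ None :: barred (w' :: ws).
Proof. by []. Qed.

Lemma barred_relabel (T1 T2 : Type) (f : T1 -> T2) (ws : seq (seq T1)) :
  barred (relabel f ws) = map (omap f) (barred ws).
Proof.
elim: ws => // w [|w' ws] IH.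
  by rewrite /= !cats0 -!map_comp.
rewrite barred_cons2 map_cat map_cons -IH /= -!map_comp //.
Qed.

Lemma count_barred (T : eqType) (c : T) (ws : seq (seq T)) :
  count_mem (Some c) (barred ws) = count_mem c (flatten ws).
Proof.
elim: ws => // w [|w' ws] IH.
  by rewrite /= !cats0 count_map; apply: eq_count => d /=.
rewrite barred_cons2 count_cat [count_mem _ (None :: _)]/= IH add0n.
rewrite [flatten (w :: _)]/= count_cat; congr addn.
by rewrite count_map; apply: eq_count => d /=.
Qed.

Lemma component_count_barred (T : eqType) (ws : seq (seq T)) i c :
  component_count (barred ws) i c = count_mem c (nth [::] ws i).
Proof.
pose N acc := occurrence_sum (fun m : nat => (m == i : nat)) (@separator_weight T) acc c.
have Nmap acc w : N acc (map Some w) = ((acc == i) * count_mem c w)%N.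
  elim: w acc => [|d w IH] acc; first by rewrite muln0.
  rewrite /N /= -/(N _ _) [_ + separator_weight _]addr0 IH mulnDr.
  rewrite (inj_eq Some_inj); by case: eqP; rewrite ?muln0 ?muln1.
have sep0 w : \sum_(o <- map Some w) @separator_weight T o = 0.
  by rewrite big_map big1.
(* Generalize to [acc] separators already passed. The factor [acc <= i] handles the case where the
   [i]-th component is already behind and [i - acc] truncates to 0. *)
suff H acc : N acc (barred ws) = ((acc <= i) * count_mem c (nth [::] ws (i - acc)))%N.
  by rewrite /component_count -/(N _ _) H subn0 mul1n.
elim: ws acc => [|w [|w' ws] IH] acc; first by rewrite nth_nil muln0.
  rewrite /= cats0 Nmap; case: ltngtP => // [lt|->]; last by rewrite subnn.
  by rewrite -(subnSK lt) /= nth_nil.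
rewrite barred_cons2 /N occurrence_sum_cat -/(N _ _) Nmap sep0 addr0.
rewrite occurrence_sum_cons add0r -/(N _ _).
have -> : acc + separator_weight (@None T) = acc.+1 by exact: addn1.
rewrite IH; case: ltngtP => [lt||->]; rewrite ?mul0n ?addr0 ?mul1n //.
  by rewrite add0r -(subnSK lt).
by rewrite subnn.
Qed.

Lemma barred_split (T : Type) (ws : seq (seq T)) k :
  (k < size ws)%N ->
  exists pre post, barred ws = pre ++ map Some (nth [::] ws k) ++ post.
Proof.
elim: ws k => // w [|w' ws] IH [|k] //; [by exists [::], [::]| |].
  by rewrite barred_cons2; exists [::], (None :: barred (w' :: ws)).
move=> /IH[pre [post E]]; rewrite barred_cons2 E.
by exists (map Some w ++ None :: pre), post; rewrite -catA.
Qed.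

Lemma count2_split (T : eqType) (c : T) (w : seq T) :
  count_mem c w = 2 ->
  exists x y z, [/\ w = x ++ c :: y ++ c :: z,
    c \notin x, c \notin y & c \notin z].
Proof.
move=> w2; have cw : c \in w by rewrite -has_pred1 has_count w2.
case/splitPr: cw w2 => x0 t0.
have [x [t [-> cx]]] : exists x t, x0 ++ c :: t0 = x ++ c :: t /\ c \notin x.
  have : c \in x0 ++ c :: t0 by rewrite mem_cat mem_head orbT.
  elim: (x0 ++ c :: t0) => // d s IH; rewrite inE.
  have [->|dc] := eqVneq c d; first by exists [::], s.
  move=> /= /IH[x [t [-> cx]]]; exists (d :: x), t; split => //.
  by rewrite inE negb_or dc.
rewrite count_cat /= eqxx (count_memPn cx) add0n add1n => -[t1].
have ct : c \in t by rewrite -has_pred1 has_count t1.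
case/splitPr: ct t1 => y z; rewrite count_cat /= eqxx => yz.
exists x, y, z; split=> //; apply/count_memPn; lia.
Qed.

Lemma big_seq_count (T : finType) (V : nmodType) (f : T -> V) (s : seq T) :
  \sum_(c <- s) f c = \sum_(c : T) f c *+ count_mem c s.
Proof.
elim: s => [|d s IH]; first by rewrite big_nil big1.
have E c : f c *+ count_mem c (d :: s) =
    (if c == d then f c else 0) + f c *+ count_mem c s.
  by rewrite /= mulrnDr mulrb eq_sym.
rewrite big_cons IH (eq_bigr _ (fun c _ => E c)) big_split -big_mkcond.
by rewrite big_pred1_eq.
Qed.

(** * Agreement with the linking vectors of a Gauss phrase *)

Section PhraseLinking.
Variables (n : nat) (T : finType) (p : gauss_phrase n T).

Lemma count_flatten_gauss c : count_mem c (flatten p) = 2.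
Proof. by case: p => ws /= /forallP/(_ c)/eqP. Qed.

Lemma component_count_tnth (i : 'I_n) c :
  component_count (barred p) i c = count_mem c (tnth p i).
Proof. by rewrite component_count_barred -tnth_nth. Qed.

Lemma count_components c : (\sum_(i < n) count_mem c (tnth p i) = 2)%N.
Proof.
have := count_flatten_gauss c.
by rewrite count_flatten sumnE big_map big_tuple.
Qed.

(** The contributions agree letter by letter modulo 2. A letter occurring twice in [y] contributes
    an even number to both sides; for one occurring once, the term [i == k] of its weight cancels
    that occurrence and leaves the component of the other one. *)
Lemma linking_vector_sum (k : 'I_n) x y z :
  tnth p k = x ++ y ++ z ->
  linking_vector p k (size x) (size x + size y) =
  \sum_(c <- y) letter_weight (barred p) k c.
Proof.
move=> pk; apply/rowP => i; rewrite !mxE summxE.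
have -> : subword (tnth p k) (size x) (size x + size y) = y.
  by rewrite /subword pk catA take_cat size_cat ltnn subnn take0 cats0 drop_size_cat.
have -> : outside (tnth p k) (size x) (size x + size y) = x ++ z.
  by rewrite /outside {1}pk take_size_cat // pk catA -size_cat drop_size_cat.
under eq_bigr => c _ do rewrite mxE component_count_tnth.
rewrite big_seq_count -sum1dep_card natr_sum big_mkcond.
apply: eq_bigr => c _; rewrite -mulrnA.
transitivity ((((count_mem c y == 1) &&
    (c \in (if i == k then x ++ z else tnth p i))) : nat)%:R : 'F_2).
  by case: ifP.
(* Each letter has two occurrences in total, which bounds its counts and leaves finitely many
   parities to check. *)
apply: eq_natr_F2; have := count_components c; rewrite (bigD1 k) //=.
rewrite -has_pred1 has_count; have [->|ik] := eqVneq i k.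
  rewrite pk !count_cat.
  by case: (count_mem c y) => [|[|[|m]]]; case: ltnP;
    rewrite ?(muln0, muln1) /=; lia.
rewrite (bigD1 i) //= pk !count_cat addn0.
by case: (count_mem c y) => [|[|[|m]]]; case: ltnP;
  rewrite ?(muln0, muln1) /=; lia.
Qed.

Lemma letter_linking_vectorE (k : 'I_n) c :
  count_mem c (tnth p k) = 2 ->
  letter_linking_vector p k c = barred_linking (barred p) k c.
Proof.
move=> c2; have [x [y [z [pk cx cy cz]]]] := count2_split c2.
have index_c s t : c \notin s -> index c (s ++ c :: t) = size s.
  by move=> cs; rewrite index_cat (negPf cs) /= eqxx addn0.
have -> : letter_linking_vector p k c =
    linking_vector p k (size (rcons x c)) (size (rcons x c) + size y).
  rewrite /letter_linking_vector /second_pos /first_pos pk index_c //.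
  by rewrite -cat_rcons -(size_rcons x c) drop_size_cat // index_c.
rewrite (@linking_vector_sum k _ _ (c :: z)) ?cat_rcons //.
have kws : (k < size p)%N by rewrite size_tuple.
have [pre [post bp]] := barred_split kws.
(* Both occurrences of [c] lie in the [k]-th component. The weights of [pre] and [x] then enter both
   prefix sums and cancel, which leaves the sum over [y]. *)
have [cpre cpost] : Some c \notin pre /\ Some c \notin post.
  have := count_flatten_gauss c.
  rewrite -count_barred bp !count_cat count_map -tnth_nth.
  rewrite (eq_count (a2 := pred1 c)) // c2.
  by move=> ?; split; apply/count_memPn; lia.
rewrite /barred_linking; set g := letter_weight _ _.
have sum_g s : \sum_(o <- map Some s) oapp g 0 o = \sum_(d <- s) g d.
  by rewrite big_map.
have Some_notin s : c \notin s -> Some c \notin map Some s.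
  by rewrite (mem_map (@Some_inj _)).
rewrite bp -tnth_nth pk map_cat map_cons map_cat map_cons.
rewrite !(occurrence_sum_cat, occurrence_sum_cons) eqxx.
rewrite !(occurrence_sum_notin _ _ _ cpre) !(occurrence_sum_notin _ _ _ cpost).
rewrite !occurrence_sum_notin ?Some_notin //.
by rewrite !sum_g /= !(addr0, add0r); char2_row.
Qed.

Lemma d_linked (k : 'I_n) v : d_ p k v = #|[pred c | linked (barred p) k v c]|.
Proof.
rewrite /d_ cardsE; apply: eq_card => c; rewrite unfold_in /= !inE /linked.
rewrite component_count_tnth; case: eqP => //= c2.
by rewrite letter_linking_vectorE.
Qed.

End PhraseLinking.

(** * Effect of the moves on linked letters *)

Lemma separator_weight_Some (T : eqType) (c : T) :
  separator_weight (Some c) = 0.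
Proof. by []. Qed.

Definition occE := (occurrence_sum_cat, occurrence_sum_cons, big_cat, big_cons,
  big_nil, separator_weight_Some, addr0, add0r).

Section Moves.
Variables (n : nat) (T : finType).
Implicit Types (s w x y z : seq (option T)) (a b c d : T) (k : 'I_n)
  (v : 'rV['F_2]_n).

Lemma eq_letter_weight s s' k c :
  (forall i, component_count s i c = component_count s' i c) ->
  letter_weight s k c = letter_weight s' k c.
Proof. by move=> eq_count; apply/rowP => i; rewrite !mxE eq_count. Qed.

(** The prefix sums are compared for letters with both occurrences in component [k] only, because H3
    may change them for other letters. *)
Lemma eq_linked s s' k v c :
  (forall i, component_count s i c = component_count s' i c) ->
  (component_count s k c = 2 ->
   occurrence_sum id (oapp (letter_weight s k) 0) 0 c s =
   occurrence_sum id (oapp (letter_weight s' k) 0) 0 c s') ->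
  linked s k v c = linked s' k v c.
Proof.
move=> eq_count eq_occ; rewrite /linked -eq_count; case: eqP => //= c2.
by rewrite /barred_linking eq_occ // (eq_letter_weight _ eq_count).
Qed.

(** The prefix sums at the two adjacent [a] differ by the weight of [a], so [a] has linking 0, which
    is not [v]. For any other letter the pair adds twice the same weight, that is 0, to later prefix
    sums. *)
Lemma linked_H1 a x y k v c : v != 0 ->
  Some a \notin x -> Some a \notin y ->
  linked (x ++ [:: Some a; Some a] ++ y) k v c = linked (x ++ y) k v c.
Proof.
move=> v0 ax ay; set s := x ++ _ ++ y.
have [<-|ac] := eqVneq a c.
  rewrite [RHS]linked_notin ?mem_cat ?negb_or ?ax //.
  apply/negP => /andP[_ /eqP vE]; case/eqP: v0; rewrite -vE /barred_linking.
  rewrite {2}/s !occE eqxx !occurrence_sum_notin // /=; char2_row.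
have count_s d i : a != d -> component_count s i d = component_count (x ++ y) i d.
  move=> ad; rewrite /component_count /s !occE.
  by rewrite !(inj_eq Some_inj) (negPf ad) !occE.
apply: eq_linked => [i|_]; first exact: count_s.
transitivity
  (occurrence_sum id (oapp (letter_weight s k) 0) 0 c (x ++ y)).
  rewrite {2}/s !occE !(inj_eq Some_inj) (negPf ac) !occE /=.
  by congr (_ + occurrence_sum _ _ _ _ _); char2_row.
apply: eq_in_occurrence_sum => -[d|] //= dxy.
apply: eq_letter_weight => i; apply: count_s; apply: contraTneq dxy => <-.
by rewrite mem_cat negb_or ax.
Qed.

Lemma linked_H2 a b x y z k v c : a != b ->
  Some a \notin x ++ y ++ z -> Some b \notin x ++ y ++ z ->
  let s := x ++ [:: Some a; Some b] ++ y ++ [:: Some b; Some a] ++ z in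
  linked s k v c =
  if (c == a) || (c == b) then linked s k v a else linked (x ++ y ++ z) k v c.
Proof.
move=> ab axyz bxyz s.
have /and3P[ax ay az] : [&& Some a \notin x, Some a \notin y & Some a \notin z].
  by rewrite -!negb_or -!mem_cat.
have /and3P[bx by_ bz] : [&& Some b \notin x, Some b \notin y & Some b \notin z].
  by rewrite -!negb_or -!mem_cat.
have ba : b != a by rewrite eq_sym.
have count_ab i : component_count s i b = component_count s i a.
  rewrite /component_count /s !occE !(inj_eq Some_inj) !eqxx.
  by rewrite (negPf ab) (negPf ba) !occurrence_sum_notin // !occE.
have gab : letter_weight s k b = letter_weight s k a.
  by apply/rowP => i; rewrite !mxE count_ab.
(* As [a] and [b] have equal weights, both sides reduce to that weight plus the sum over [y]. *)
have occ_ab : occurrence_sum id (oapp (letter_weight s k) 0) 0 b s =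
    occurrence_sum id (oapp (letter_weight s k) 0) 0 a s.
  rewrite {2 4}/s !occE !(inj_eq Some_inj) !eqxx (negPf ab) (negPf ba).
  by rewrite !occurrence_sum_notin // /= gab; char2_row.
case: (eqVneq c a) => [->//|ca]; case: (eqVneq c b) => [->|cb] /=.
  by rewrite /linked count_ab /barred_linking gab occ_ab.
have count_s d i :
    d != a -> d != b -> component_count s i d = component_count (x ++ y ++ z) i d.
  move=> da db; rewrite /component_count /s !occE.
  by rewrite !(inj_eq Some_inj) ![_ == d]eq_sym (negPf da) (negPf db) !occE.
apply: eq_linked => [i|_]; first exact: count_s.
transitivity
  (occurrence_sum id (oapp (letter_weight s k) 0) 0 c (x ++ y ++ z)).
  rewrite {2}/s !occE !(inj_eq Some_inj) ![_ == c]eq_sym (negPf ca) (negPf cb).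
  by rewrite !occE /= gab !addvv !addr0.
apply: eq_in_occurrence_sum => -[d|] //= dxyz.
by apply: eq_letter_weight => i; apply: count_s;
  apply: contraTneq dxyz => ->.
Qed.

Lemma linked_H3 a b c w x y z k v d : uniq [:: a; b; c] ->
  (forall e, e \in [:: a; b; c] -> Some e \notin w ++ x ++ y ++ z) ->
  linked (w ++ [:: Some a; Some b] ++ x ++ [:: Some a; Some c] ++ y
            ++ [:: Some b; Some c] ++ z) k v d =
  linked (w ++ [:: Some b; Some a] ++ x ++ [:: Some c; Some a] ++ y
            ++ [:: Some c; Some b] ++ z) k v d.
Proof.
rewrite /= !inE negb_or andbT => /andP[/andP[ab ac] bc] abcN.
set s := w ++ _; set s' := w ++ _.
have neqs : ((a == b = false) * (b == a = false) * (a == c = false) *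
    (c == a = false) * (b == c = false) * (c == b = false))%type.
  by rewrite (eq_sym b a) (eq_sym c a) (eq_sym c b) (negPf ab) (negPf ac) (negPf bc).
have notin e : e \in [:: a; b; c] ->
    [/\ Some e \notin w, Some e \notin x, Some e \notin y & Some e \notin z].
  by move/abcN; rewrite !mem_cat !negb_or => /and4P.
have [aw ax ay az] := notin a (mem_head _ _).
have [bw bx by_ bz] : [/\ Some b \notin w, Some b \notin x, Some b \notin y
  & Some b \notin z] by apply: notin; rewrite !inE eqxx orbT.
have [cw cx cy cz] : [/\ Some c \notin w, Some c \notin x, Some c \notin y
  & Some c \notin z] by apply: notin; rewrite !inE eqxx !orbT.
have count_s e i : component_count s i e = component_count s' i e.
  rewrite /component_count /s /s' !occE.
  congr (_ + _).
  (* Letters have separator weight 0, so swapping two neighbours only permutes two terms. *)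
  do 3![rewrite addrCA; do 3!congr (_ + _)].
have swap_weight e : letter_weight s' k e = letter_weight s k e.
  exact: eq_letter_weight.
apply: eq_linked => // d2.
transitivity
  (occurrence_sum id (oapp (letter_weight s k) 0) 0 d s'); last first.
  by apply: eq_in_occurrence_sum => -[e|] // _; rewrite /= swap_weight.
(* [n1], [n2], [n3] are the components of the three displayed pairs, given by the number of
   separators before each. *)
have [n1 [n2 [n3 count_abc]]] : exists n1 n2 n3 : nat, forall i,
    [/\ component_count s i a = ((n1 == i) + (n2 == i))%N,
        component_count s i b = ((n1 == i) + (n3 == i))%N
      & component_count s i c = ((n2 == i) + (n3 == i))%N].
  pose sep := \sum_(o <- _) @separator_weight T o.
  exists (sep w), (sep w + sep x), (sep w + sep x + sep y) => i.
  split; rewrite /component_count /s !occE !(inj_eq Some_inj) eqxx !neqs;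
    by rewrite !occurrence_sum_notin // !occE.
rewrite {2}/s /s' !occE !(inj_eq Some_inj).
have noE e (r : seq (option T)) (er : Some e \notin r) t :
    occurrence_sum id (oapp (letter_weight s k) 0) t e r = 0.
  exact: occurrence_sum_notin.
have [da|da] := eqVneq d a.
  (* If both [a] lie in component [k], then [n1 = n2 = k], so [b] and [c] both occur in components
     [k] and [n3]. The move shifts the two prefix sums at [a] by the weights of [b] and [c], which
     cancel. The cases of [b] and [c] are analogous. *)
  have gbc : letter_weight s k b = letter_weight s k c.
    have [d2' _ _] := count_abc k; move: d2; rewrite da d2'.
    case: eqP => // n1k; case: eqP => // n2k _; apply/rowP => i; rewrite !mxE.
    by have [_ -> ->] := count_abc i; rewrite n1k n2k.
  rewrite da !neqs !(noE _ _ aw, noE _ _ ax, noE _ _ ay, noE _ _ az) /= gbc; char2_row.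
have [db|db] := eqVneq d b.
  have gac : letter_weight s k a = letter_weight s k c.
    have [_ d2' _] := count_abc k; move: d2; rewrite db d2'.
    case: eqP => // n1k; case: eqP => // n3k _; apply/rowP => i; rewrite !mxE.
    by have [-> _ ->] := count_abc i; rewrite n1k n3k (addnC (n2 == i)).
  rewrite db !neqs !(noE _ _ bw, noE _ _ bx, noE _ _ by_, noE _ _ bz) /= gac; char2_row.
have [dc|dc] := eqVneq d c.
  have gab : letter_weight s k a = letter_weight s k b.
    have [_ _ d2'] := count_abc k; move: d2; rewrite dc d2'.
    case: eqP => // n2k; case: eqP => // n3k _; apply/rowP => i; rewrite !mxE.
    by have [-> -> _] := count_abc i; rewrite n2k n3k.
  rewrite dc !(noE _ _ cw, noE _ _ cx, noE _ _ cy, noE _ _ cz) /= gab; char2_row.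
(* For any other letter, each swap only reorders two weights inside a prefix sum. *)
rewrite !occE /=.
by rewrite !(addrAC _ (letter_weight s k b) (letter_weight s k a))
  !(addrAC _ (letter_weight s k c)).
Qed.

End Moves.

(** * Invariance of the parities and of [S_o] *)

Section Invariance.
Variable n : nat.

Lemma d_barred_map (T1 T2 : finType) (p : gauss_phrase n T1) (f : T1 -> T2)
    (k : 'I_n) v :
  injective f ->
  d_ p k v = #|[pred c | linked (barred (relabel f p)) k v c]|.
Proof. by move=> inj_f; rewrite d_linked barred_relabel card_linked_map. Qed.

Lemma barred_val_notin (T : finType) (P : pred T) (ws : seq (seq {c : T | P c}))
    a :
  ~~ P a -> Some a \notin barred (relabel val ws).
Proof.
move=> Pa; rewrite barred_relabel; apply/mapP => -[[c|//] _ [aE]].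
by move: Pa; rewrite aE (valP c).
Qed.

Lemma odd_d_step (T1 T2 : finType) (p : gauss_phrase n T1)
    (q : gauss_phrase n T2) (k : 'I_n) v :
  elementary_step p q -> v != 0 -> odd (d_ p k v) = odd (d_ q k v).
Proof.
case=> {T1 T2 p q}
  [T1 T2 p q f bij_f pq|T a p q x y ps qs|T a b p q x y z ab ps qs
  |T a b c p q w x y z abc ps qs] v0.
- by rewrite (d_barred_map p k v (bij_inj bij_f)) pq -d_linked.
- rewrite d_linked (d_barred_map q k v val_inj) ps qs; congr odd.
  have : Some a \notin x ++ y by rewrite -qs barred_val_notin ?eqxx.
  rewrite mem_cat negb_or => /andP[ax ay].
  by apply: eq_card => c; rewrite !inE linked_H1.
- rewrite d_linked (d_barred_map q k v val_inj) ps qs.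
  have axyz : Some a \notin x ++ y ++ z.
    by rewrite -qs barred_val_notin ?eqxx.
  have bxyz : Some b \notin x ++ y ++ z.
    by rewrite -qs barred_val_notin // eqxx andbF.
  (* Split off [a] and [b]: they are both linked or both not, so together they contribute an even
     number. *)
  rewrite (cardD1 a) (cardD1 b) !inE eq_sym ab /= addnA oddD.
  rewrite (linked_H2 k v b ab axyz bxyz) eqxx orbT addnn odd_double addFb.
  congr odd; apply: eq_card => c; rewrite !inE linked_H2 //.
  case: (eqVneq c a) => [->|_].
    by rewrite (linked_notin _ _ axyz) ?andbF.
  by case: (eqVneq c b) => [->|_] //=; rewrite (linked_notin _ _ bxyz).
- rewrite !d_linked; congr odd; apply: eq_card => d; rewrite !inE ps qs.
  apply: linked_H3 => // e e_abc; apply/count_memPn; rewrite !count_cat.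
  (* The two displayed occurrences of [e] are all it has, so none is left for [w], [x], [y], [z]. *)
  have := count_flatten_gauss p e; rewrite -count_barred ps !count_cat /=.
  by move: e_abc; rewrite !inE => /or3P[] /eqP->; rewrite eqxx; lia.
Qed.

Lemma S_o_step (T1 T2 : finType) (p : gauss_phrase n T1)
    (q : gauss_phrase n T2) :
  elementary_step p q -> S_o p = S_o q.
Proof.
move=> pq; apply: eq_from_tnth => k; rewrite !tnth_mktuple; apply/setP => v.
by rewrite !inE; case: eqVneq => //= v0; apply: odd_d_step.
Qed.

End Invariance.

Theorem theorem4p3 (n : nat) (T1 T2 : finType)
    (p : gauss_phrase n T1) (q : gauss_phrase n T2) :
  open_homotopic p q -> S_o p = S_o q.
Proof.
elim=> {T1 T2 p q} // [T1 T2 p q /S_o_step //|T1 T2 T3 p q r _ -> _ -> //].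
Qed.
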